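(* Let $(C,\phi)$ be a multistate monotone system, let $k\in\{1,\ldots,M\}$, and let $\mathfrak{P}_k$ be the set of minimal $k$-level path vectors. Then for all $\bm{y}\in\mathfrak{C}$, $$\phi_k(\bm{y})=\sum_{\bm{x}\in\mathrm{cl}(\mathfrak{P}_k)}\delta_k(\bm{x})\,\mathrm{I}(\bm{y}\ge\bm{x}),$$ where $\delta_k$ is the signed domination function of $\mathrm{cl}(\mathfrak{P}_k)$.
   Context: A multistate monotone system (MMS) $(C,\phi)$ has component set $C=\{1,\ldots,n\}$, component state sets $\mathcal{S}_i=\{0,1,\ldots,m_i\}$, component state space $\mathfrak{C}=\mathcal{S}_1\times\cdots\times\mathcal{S}_n$, system state set $\{0,1,\ldots,M\}$, and a structure function $\phi:\mathfrak{C}\to\{0,\ldots,M\}$ non-decreasing in each argument. The $k$-level structure function is $\phi_k(\bm{x})=\mathrm{I}(\phi(\bm{x})\ge k)$, $\mathrm{I}$ the indicator. Vectors are ordered componentwise ($\bm{y}\le\bm{x}$ iff $y_i\le x_i$ for all $i$; $\bm{y}<\bm{x}$ iff $\bm{y}\le\bm{x}$ and $\bm{y}\ne\bm{x}$). A minimal $k$-level path vector is $\bm{x}\in\mathfrak{C}$ with $\phi(\bm{x})\ge k$ and $\phi(\bm{y})<k$ for all $\bm{y}\in\mathfrak{C}$ with $\bm{y}<\bm{x}$. For a set $\mathfrak{X}$ of pairwise incomparable vectors, $\mathrm{cl}(\mathfrak{X})$ is the smallest set containing $\mathfrak{X}$ closed under componentwise maximum $\vee$. A formation of $\bm{x}\in\mathrm{cl}(\mathfrak{X})$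 is a nonempty subset $\{\bm{x}_{i_1},\ldots,\bm{x}_{i_j}\}\subseteq\mathfrak{X}$ with $\bm{x}=\bm{x}_{i_1}\vee\cdots\vee\bm{x}_{i_j}$, odd or even according to the parity of $j$; the signed domination function is $\delta(\bm{x})=$ (number of odd formations) $-$ (number of even formations). *)

(* Defs.v *)
From HB Require Import structures.
From mathcomp Require Import all_boot all_order all_algebra.
Set Implicit Arguments.
Unset Strict Implicit.
Unset Printing Implicit Defensive.
Import Order.TTheory.

(* Components are indexed by 'I_n = {0, ..., n-1} instead of {1, ..., n};
   component i has the states {0, ..., m i}, i.e. the ordinals below (m i).+1. *)
Notation states m := {dffun forall i, 'I_(m i).+1}.

Section Vectors.
Variables (n : nat) (m : 'I_n -> nat).
Implicit Types x y z : states m.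

Definition vle x y : bool := [forall i, x i <= y i].
Definition vlt x y : bool := vle x y && (x != y).

Definition vjoin x y : states m := [ffun i => Order.max (x i) (y i)].
Definition vzero : states m := [ffun i => ord0].

Lemma vjoinA : associative vjoin.
Proof. by move=> x y z; apply/ffunP=> i; rewrite !ffunE maxA. Qed.

Lemma vjoinC : commutative vjoin.
Proof. by move=> x y; apply/ffunP=> i; rewrite !ffunE maxC. Qed.

Lemma vjoin0 : left_id vzero vjoin.
Proof. by move=> x; apply/ffunP=> i; rewrite !ffunE; apply/max_idPr; rewrite leEord. Qed.

HB.instance Definition _ :=
  Monoid.isComLaw.Build (states m) vzero vjoin vjoinA vjoinC vjoin0.

Implicit Types X Y F : {set states m}.

Definition join_closed Y : bool :=
  [forall x in Y, forall y in Y, vjoin x y \in Y].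

Definition join_cl X : {set states m} :=
  \bigcap_(Y : {set states m} | (X \subset Y) && join_closed Y) Y.

(* The unit vzero of the iterated join is harmless: it is the least vector
   and formations are nonempty. *)
Definition formation X x F : bool :=
  [&& F != set0, F \subset X & \big[vjoin/vzero]_(z in F) z == x].

Definition odd_formations X x : {set {set states m}} :=
  [set F | formation X x F & odd #|F|].
Definition even_formations X x : {set {set states m}} :=
  [set F | formation X x F & ~~ odd #|F|].

Definition signed_domination X x : int :=
  (#|odd_formations X x|%:Z - #|even_formations X x|%:Z)%R.

End Vectors.

Section Systems.
Variables (n M : nat) (m : 'I_n -> nat) (phi : states m -> 'I_M.+1).

Definition nondecreasing_in_each_argument : Prop :=
  forall (i : 'I_n) (x y : states m),
    (forall j, j != i -> x j = y j) -> x i <= y i -> phi x <= phi y.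

Definition level_structure (k : nat) (x : states m) : bool := k <= phi x.

Definition min_path_vector (k : nat) (x : states m) : bool :=
  (k <= phi x) && [forall y : states m, vlt y x ==> (phi y < k)].

Definition min_path_vectors (k : nat) : {set states m} :=
  [set x | min_path_vector k x].

End Systems.

(* Main.v *)
(** Each side counts formations: by definition of the signed domination, the
    right-hand side is the sum of (-1)^(|F|+1) over the nonempty sets F of
    minimal path vectors whose join is below y, that is, over the nonempty
    subsets of the set Q of minimal path vectors below y. As the alternating sum
    over all subsets of Q vanishes unless Q is empty, this is 1 if Q is nonempty
    and 0 otherwise; and by monotonicity Q is nonempty exactly when y is at
    level k. *)
Require Import Defs.
From mathcomp Require Import all_boot all_order all_algebra.
Set Implicit Arguments.
Unset Strict Implicit.
Unset Printing Implicit Defensive.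
Import Order.TTheory GRing.Theory.

(** Distributing the product over [i] of [(if i \in A then -1 else 0) + 1] yields one term per set
    [F], equal to the sign of [F] if [F] lies in [A] and to 0 otherwise. Evaluated directly, the
    product has a factor 0 for each element of [A]. *)
Lemma sum_sign_subsets (T : finType) (R : comPzRingType) (A : {set T}) :
  (\sum_(F : {set T} | F \subset A) (-1) ^+ #|F| = (A == set0)%:R :> R)%R.
Proof.
have <- : (\prod_i ((if i \in A then -1 else 0) + 1) = (A == set0)%:R :> R)%R.
  rewrite (bigID [pred i | i \in A]) /= [X in (_ * X)%R]big1 ?mulr1; last first.
    by move=> i /negPf->; rewrite add0r.
  rewrite (eq_bigr (fun=> 0%R)); last by move=> i ->; rewrite addNr.
  by rewrite prodr_const expr0n cards_eq0.
rewrite bigA_distr.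
rewrite [RHS](bigID [pred F : {set T} | F \subset A]) /=.
rewrite [X in (_ + X)%R]big1 ?addr0; last first.
  by move=> F /subsetPn[i iF iA]; rewrite (bigD1 i) //= iF (negPf iA) mul0r.
apply: eq_bigr => F /subsetP sFA.
by rewrite -big_mkcond /= -prodr_const; apply: eq_bigr => i /sFA ->.
Qed.

Section VectorOrder.
Variables (n : nat) (m : 'I_n -> nat).
Implicit Types (x y z : states m) (X F : {set states m}).

Lemma vle_refl x : vle x x.
Proof. by apply/forallP. Qed.

Lemma vle_trans y x z : vle x y -> vle y z -> vle x z.
Proof.
by move=> /forallP xy /forallP yz; apply/forallP=> i; apply: leq_trans (yz i).
Qed.

Lemma vle0x x : vle (vzero m) x.
Proof. by apply/forallP=> i; rewrite ffunE. Qed.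

Lemma vle_join x y z : vle (vjoin x y) z = vle x z && vle y z.
Proof.
have max_le i : (vjoin x y i <= z i) = (x i <= z i) && (y i <= z i).
  by rewrite ffunE; have := ge_max (z i) (x i) (y i); rewrite !leEord.
apply/forallP/andP => [xyz | [/forallP xz /forallP yz] i].
  by split; apply/forallP=> i; have := xyz i; rewrite max_le => /andP[].
by rewrite max_le xz yz.
Qed.

Lemma vle_bigjoin F y :
  vle (\big[@vjoin n m/vzero m]_(z in F) z) y = [forall z in F, vle z y].
Proof.
rewrite -big_andE; apply: (big_morph (fun x => vle x y)) => [x z|].
  exact: vle_join.
exact: vle0x.
Qed.

(** Supplies a rank: a vector with least coordinate sum in a set is minimal there for [vlt]. *)
Lemma vlt_sum x y : vlt x y -> \sum_i x i < \sum_i y i.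
Proof.
case/andP=> /forallP xy; apply: contraNltn => yx.
apply/eqP/ffunP=> i; apply/val_inj/eqP; rewrite eqn_leq xy /=.
move: yx; rewrite (bigD1 i) //= [X in _ <= X](bigD1 i) //= leqNgt.
apply: contraR; rewrite -ltnNge => xyi.
by rewrite -addSn leq_add // leq_sum.
Qed.

Lemma bigjoin_in_join_cl X F : F != set0 -> F \subset X ->
  \big[@vjoin n m/vzero m]_(z in F) z \in join_cl X.
Proof.
case/set0Pn=> z0 z0F sFX; apply/bigcapP=> Y /andP[sXY clY].
have joinY x y : x \in Y -> y \in Y -> vjoin x y \in Y.
  by move=> xY yY; have /forall_inP/(_ x xY)/forall_inP/(_ y yY) := clY.
have sFY z : z \in F -> z \in Y by move/(subsetP sFX)/(subsetP sXY).
rewrite (bigD1 z0) //=.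
(* Stated for translates because Y need not contain the unit of the join. *)
suff absY : forall v, v \in Y ->
    vjoin v (\big[@vjoin n m/vzero m]_(z in F | z != z0) z) \in Y.
  exact/absY/sFY.
elim/big_ind: _ => [v|x y IHx IHy v vY|z /andP[zF _] v vY].
- by rewrite vjoinC vjoin0.
- by rewrite vjoinA; apply/IHy/IHx.
- exact/joinY/sFY.
Qed.

Lemma signed_dominationE X x :
  (signed_domination X x = \sum_(F | formation X x F) (-1) ^+ #|F|.+1)%R.
Proof.
rewrite (bigID [pred F : {set states m} | odd #|F|]) /= /signed_domination.
rewrite (eq_bigr (fun=> 1%R)); last first.
  by move=> F /andP[_ oF]; rewrite -signr_odd /= oF.
rewrite [X in (_ = _ + X)%R](eq_bigr (fun=> (-1)%R)); last first.
  by move=> F /andP[_ /negPf oF]; rewrite -signr_odd /= oF.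
by rewrite sumrN !sumr_const !cardsE !natz.
Qed.

Lemma sum_signed_domination X y :
  (\sum_(x in join_cl X) signed_domination X x * (vle x y)%:Z =
   (~~ [forall z in X, ~~ vle z y])%:Z)%R.
Proof.
pose J F := \big[@vjoin n m/vzero m]_(z in F) z.
pose Q := [set z in X | vle z y].
transitivity (\sum_(F : {set states m} | (F \subset Q) && (F != set0))
                (-1) ^+ #|F|.+1 : int)%R; last first.
  (* Isolating the term 1 of the empty set and flipping the signs turns the sum over nonempty
     subsets into 1 minus the indicator that [Q] is empty. *)
  have := @sum_sign_subsets (states m) int Q.
  rewrite (bigD1 set0) ?sub0set //= cards0 expr0.
  under [in X in _ -> X]eq_bigr do rewrite exprS mulN1r.
  rewrite sumrN => /(canRL (addKr _)) ->.
  have -> : (Q == set0) = [forall z in X, ~~ vle z y].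
    apply/eqP/forall_inP => [Q0 z zX | XnQ].
      by have := in_set0 z; rewrite -Q0 inE zX /= => ->.
    by apply/setP=> z; rewrite !inE; apply/negP => /andP[/XnQ/negPf->].
  by case: [forall z in X, _].
under eq_bigr do rewrite signed_dominationE mulr_suml big_mkcond.
rewrite exchange_big /= [RHS]big_mkcond; apply: eq_bigr => F _.
have sFQ : (F \subset Q) = (F \subset X) && vle (J F) y.
  rewrite vle_bigjoin.
  apply/subsetP/andP => [sFQ | [/subsetP sFX /forall_inP Fy] z zF].
    split; [apply/subsetP | apply/forall_inP] => z /sFQ;
      by rewrite inE => /andP[].
  by rewrite inE sFX ?Fy.
rewrite -big_mkcondr /= sFQ.
case F0: (F != set0); last first.
  by rewrite andbF big1 // => x; rewrite /formation F0 andbF.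
case sFX: (F \subset X); last first.
  by rewrite big1 // => x; rewrite /formation sFX !andbF.
(* A nonempty [F] inside [X] is a formation of exactly one vector, its join [J F], which lies in the
   closure; the inner sum therefore has a single term. *)
rewrite (big_pred1 (J F)) => [|x]; first by case: vle; rewrite ?mulr1 ?mulr0.
rewrite /formation F0 sFX /= eq_sym andbC.
by case: eqP => //= ->; apply: bigjoin_in_join_cl.
Qed.

End VectorOrder.

Section MonotoneSystems.
Variables (n M : nat) (m : 'I_n -> nat) (phi : states m -> 'I_M.+1).
Hypothesis phi_mono : nondecreasing_in_each_argument phi.

Lemma vle_structure_mono x y : vle x y -> phi x <= phi y.
Proof.
move=> /forallP xy.
(* The path from [x] to [y] raises one coordinate at a time, so consecutive vectors [h j] and
   [h j.+1] differ at most at coordinate [j]. *)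
pose h j : states m := [ffun i : 'I_n => if i < j then y i else x i].
have h0 : h 0 = x by apply/ffunP=> i; rewrite ffunE.
have hn : h n = y by apply/ffunP=> i; rewrite ffunE ltn_ord.
suff hP j : j <= n -> phi x <= phi (h j) by rewrite -hn hP.
elim: j => [|j IHj] jn; first by rewrite h0.
apply: leq_trans (IHj (ltnW jn)) _.
apply: (phi_mono (i := Ordinal jn)) => [i ij|]; rewrite !ffunE /=.
  by rewrite (ltn_neqAle i j) (ij : i != j :> nat).
by rewrite ltnn ltnSn.
Qed.

Lemma min_path_vector_below k y : k <= phi y ->
  exists2 z, z \in min_path_vectors phi k & vle z y.
Proof.
move=> ky; pose P z := (k <= phi z) && vle z y.
have Py : P y by rewrite /P ky vle_refl.
(* Among the vectors below [y] at level [k], take one with least coordinate sum; a strictly smaller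
   vector at level [k] would again be below [y], with a smaller sum. *)
case: (@arg_minnP _ y P (fun z => \sum_i z i) Py) => z /andP[kz zy] zmin.
exists z => //; rewrite inE /min_path_vector kz /=.
apply/forall_inP => x xz; rewrite ltnNge; apply/negP => kx.
have /zmin : P x by rewrite /P kx (vle_trans _ zy) //; case/andP: xz.
by rewrite leqNgt vlt_sum.
Qed.

Lemma level_structureE k y :
  level_structure phi k y =
  ~~ [forall z in min_path_vectors phi k, ~~ vle z y].
Proof.
apply/idP/forall_inPn => [/min_path_vector_below[z zP zy] | [z]].
  by exists z; rewrite ?negbK.
rewrite inE negbK => /andP[kz _] zy.
exact: leq_trans kz (vle_structure_mono zy).
Qed.

End MonotoneSystems.

Theorem theorem3p2 (n M : nat) (m : 'I_n -> nat) (phi : states m -> 'I_M.+1)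
    (phi_mono : nondecreasing_in_each_argument phi)
    (k : nat) (k_bounds : 1 <= k <= M) (y : states m) :
  ((level_structure phi k y)%:Z =
     \sum_(x in join_cl (min_path_vectors phi k))
        signed_domination (min_path_vectors phi k) x * (vle x y)%:Z)%R.
Proof. by rewrite sum_signed_domination -level_structureE. Qed.
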